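(* Let $k$ be a field of characteristic $0$. The product $\circ$ and coproduct $\Delta$ on planar rooted trees (defined via balanced bracket arrangements) make $k\mathcal P$ a graded connected Hopf algebra.
   Context: A planar rooted tree is a rooted tree in which the children of each vertex are linearly ordered (a realization of a rooted tree in the plane). $\mathcal P$ is the set of planar rooted trees, $\mathcal P_n$ the subset of those with $n$ non-root vertices, and $k\mathcal P=\bigoplus_{n\ge0}k\mathcal P_n$ the graded vector space with basis $\mathcal P$. A balanced bracket arrangement (BBA) of weight $n$ is a word in the symbols $\langle$ and $\rangle$ in which each symbol occurs $n$ times and such that, reading left to right, the count of $\langle$'s never falls behind the count of $\rangle$'s. A BBA $c$ is irreducible if $c=\langle c'\rangle$ for some BBA $c'$. Every BBA is uniquely a juxtaposition $c_1c_2\cdots c_k$ of irreducible BBAs, called its components (the empty BBA has no components). Planar rooted trees with $n$ non-root vertices correspond bijectively to BBAs of weight $n$: the one-vertex tree $\bullet$ corresponds to the empty BBA, and recursively the components $c_i=\langle c_i'\rangle$ of a BBA correspond in order to the branches of the root, $c_i'$ being the BBA of the $i$th branch (as a planar rooted tree). Elements of $k\mathcal P$ are identified with linear combinations of BBAs. Product: if $T,T'$ are represented by BBAs $c,c'$ and $c=c_1c_2\cdots c_k$ is the decomposition of $c$ into components, then $T\circ T'$ is the sum of the planar rooted trees corresponding to the asymmetric shuffle product of $c$ with $c'$, i.e. the sum (with multiplicity) of all BBAs obtained by shuffling the $k$ symbols $c_1,c_2,\dots,c_k$ (each treated as a single letter, their order preserved) into the word of individual bracket symbols $c'$ (order preserved).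 For example, for $c=c_1c_2$ and $c'=\langle\rangle$ it is $c_1c_2\langle\rangle+c_1\langle c_2\rangle+c_1\langle\rangle c_2+\langle c_1c_2\rangle+\langle c_1\rangle c_2+\langle\rangle c_1c_2$. Coproduct: for a BBA $c$ with components $c=c_1c_2\cdots c_k$, $\Delta(c)=\sum_{i=0}^k c_1\cdots c_i\otimes c_{i+1}\cdots c_k$. A graded connected Hopf algebra is a Hopf algebra $\mathcal A=\bigoplus_{n\ge0}\mathcal A_n$ with product and coproduct respecting the grading, $\mathcal A_0=k1$, and counit sending $1$ to $1$ and positive-degree elements to $0$. *)

(* Defs.v *)
From HB Require Import structures.
From mathcomp Require Import all_boot all_order all_algebra finmap.
From mathcomp Require Export monalg.

Set Implicit Arguments.
Unset Strict Implicit.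
Unset Printing Implicit Defensive.

Import GRing.Theory.

Notation bracket := bool (only parsing).
Notation lb := true (only parsing).
Notation rb := false (only parsing).
Definition word := seq bracket.

Definition balanced (w : word) : bool :=
  (count_mem lb w == count_mem rb w) &&
  [forall i : 'I_(size w).+1,
     count_mem rb (take i w) <= count_mem lb (take i w)].

Definition enclose (w : word) : word := lb :: rcons w rb.

Definition irreducible_bba (c : word) : Prop :=
  exists2 c' : word, balanced c' & c = enclose c'.

(* [Node s] is the tree whose root has the branches listed, in order, in [s]. *)
Inductive ptree : Type := Node of seq ptree.

Definition branches (T : ptree) : seq ptree := let: Node s := T in s.

Fixpoint nonroot (T : ptree) : nat :=
  let: Node s := T in sumn [seq (nonroot t).+1 | t <- s].

Fixpoint bba_of (T : ptree) : word :=
  let: Node s := T in flatten [seq enclose (bba_of t) | t <- s].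

(* Reads [w] from left to right; [cur] holds the branches already completed at
   the current vertex, and [st] those of its proper ancestors (innermost
   first).  The value on words that are not balanced is irrelevant. *)
Fixpoint parse (w : word) (st : seq (seq ptree)) (cur : seq ptree) : ptree :=
  match w, st with
  | [::], _ => Node cur
  | lb :: w', _ => parse w' (cur :: st) [::]
  | rb :: w', p :: st' => parse w' st' (rcons p (Node cur))
  | rb :: _, [::] => Node cur
  end.

Definition tree_of (w : word) : ptree := parse w [::] [::].

Definition ptree_rect_seq (P : ptree -> Prop)
    (IH : forall s, foldr (fun t Q => P t /\ Q) True s -> P (Node s)) :
  forall T, P T :=
  fix rec T := let: Node s := T in
    IH s ((fix recs (s : seq ptree) : foldr (fun t Q => P t /\ Q) True s :=
             match s with
             | [::] => I
             | t :: s' => conj (rec t) (recs s')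
             end) s).

Lemma parse_bba_of T w st cur :
  parse (bba_of T ++ w) st cur = parse w st (cur ++ branches T).
Proof.
elim/ptree_rect_seq: T w st cur => s /=.
elim: s => [|t s IHs] /= => [_|[IHt /IHs{}IHs]] w st cur; first by rewrite cats0.
by rewrite cat_rcons -!catA IHt /= IHs cat_rcons; case: t {IHt}.
Qed.

Lemma bba_ofK : cancel bba_of tree_of.
Proof.
by move=> T; rewrite -[bba_of T]cats0 /tree_of parse_bba_of /=; case: T.
Qed.

HB.instance Definition _ := Countable.copy ptree (can_type bba_ofK).

(* Balancedness by one left-to-right scan, [h] brackets being already open. *)
Fixpoint scan (h : nat) (w : word) : bool :=
  match w with
  | [::] => h == 0
  | lb :: w' => scan h.+1 w'
  | rb :: w' => (0 < h) && scan h.-1 w'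
  end.

Lemma scanP h w :
  reflect (h + count_mem lb w = count_mem rb w /\
           forall i, count_mem rb (take i w) <= h + count_mem lb (take i w))
          (scan h w).
Proof.
apply: (iffP idP).
  elim: w h => [|[] w IHw] h /=.
  - by move=> /eqP->.
  - move/IHw=> [e H]; split; first by rewrite addnCA addnA add1n.
    by case=> [|i] //=; rewrite addnCA addnA add1n add0n.
  - case: h => [|h] //= /IHw [e H]; split; first by rewrite add0n add1n addSn e.
    by case=> [|i] //=; rewrite add0n add1n addSn ltnS.
elim: w h => [|[] w IHw] h /= [e H].
- by move: e; rewrite addn0 => ->.
- apply: IHw; split; first by move: e; rewrite addnCA addnA add1n.
  by move=> i; move: (H i.+1); rewrite /= addnCA addnA add1n add0n.
- case: h e H => [|h] e H; first by move: (H 1); rewrite /= take0.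
  apply: IHw; split; first by move: e; rewrite add0n add1n addSn => -[].
  by move=> i; move: (H i.+1); rewrite /= add0n add1n addSn ltnS.
Qed.

Lemma balancedE w : balanced w = scan 0 w.
Proof.
apply/idP/scanP => [/andP[/eqP e /forallP H]|[e H]].
  split=> // i; have [lt_i|ge_i] := ltnP i (size w).+1.
    exact: (H (Ordinal lt_i)).
  by rewrite take_oversize ?(ltnW ge_i) // -e.
by rewrite /balanced -e eqxx; apply/forallP=> i; apply: H.
Qed.

Lemma scan_catl h c w : scan 0 c -> scan h (c ++ w) = scan h w.
Proof.
have H: forall g, scan g c -> scan (g + h) (c ++ w) = scan h w.
  elim: c => [|[] c IHc] g /=; first by move/eqP->.
    by move/IHc; rewrite addSn.
  by case: g => [|g] //= /IHc.
exact: H.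
Qed.

Lemma enclose_balanced w : balanced w -> balanced (enclose w).
Proof.
rewrite !balancedE /enclose -cats1 /= => H.
by rewrite scan_catl.
Qed.

Lemma bba_of_balanced T : balanced (bba_of T).
Proof.
elim/ptree_rect_seq: T => s /=.
elim: s => [|t s IHs] //= => [_|[IHt /IHs{}IHs]]; first by rewrite balancedE.
rewrite balancedE -/(enclose _) -cat_cons scan_catl -?balancedE //.
exact: enclose_balanced.
Qed.

Lemma bba_of_parse w st cur : scan (size st) w ->
  bba_of (parse w st cur) =
  foldl (fun u p => bba_of (Node p) ++ lb :: u) (bba_of (Node cur) ++ w) st.
Proof.
elim: w st cur => [|[] w IHw] st cur.
- by move/nilP->; rewrite /= cats0.
- by move=> /= H; rewrite IHw.
- case: st => [|p st] //= H; rewrite IHw //; congr foldl.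
  by rewrite /= map_rcons flatten_rcons /enclose /= -!catA /= cat_rcons.
Qed.

Lemma tree_ofK w : balanced w -> bba_of (tree_of w) = w.
Proof. by rewrite balancedE => H; rewrite /tree_of bba_of_parse. Qed.

Lemma count_bba_of T :
  count_mem lb (bba_of T) = nonroot T /\ count_mem rb (bba_of T) = nonroot T.
Proof.
suff H : count_mem lb (bba_of T) = nonroot T.
  by split=> //; have /andP[/eqP <- _] := bba_of_balanced T.
elim/ptree_rect_seq: T => s /=.
elim: s => [|t s IHs] //= [IHt /IHs{}IHs].
by rewrite /enclose /= -cats1 !count_cat IHs IHt /= !addn0 add1n addSn.
Qed.

Definition components (c : word) : seq word :=
  [seq enclose (bba_of t) | t <- branches (tree_of c)].

Lemma components_flatten c : balanced c -> flatten (components c) = c.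
Proof.
move=> /tree_ofK {2}<-; rewrite /components.
by case: (tree_of c).
Qed.

Lemma components_irreducible c d : d \in components c -> irreducible_bba d.
Proof. by case/mapP=> t _ ->; exists (bba_of t); rewrite ?bba_of_balanced. Qed.

Lemma components_unique s :
  (forall d, d \in s -> irreducible_bba d) -> components (flatten s) = s.
Proof.
move=> H.
have [ts ->] : exists ts, s = [seq enclose (bba_of t) | t <- ts].
  elim: s H => [|d s IHs] H; first by exists [::].
  have [//|ts ->] := IHs; first by move=> e es; apply: H; rewrite in_cons es orbT.
  have [c' bc ->] := H d (mem_head _ _).
  by exists (tree_of c' :: ts); rewrite /= tree_ofK.
by rewrite /components -[flatten _]/(bba_of (Node ts)) bba_ofK.
Qed.

Fixpoint shuffle (X : Type) (s : seq X) : seq X -> seq (seq X) :=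
  fix shuffle_s (t : seq X) : seq (seq X) :=
    match s, t with
    | [::], _ => [:: t]
    | _, [::] => [:: s]
    | x :: s', y :: t' =>
        [seq x :: u | u <- shuffle s' t] ++ [seq y :: u | u <- shuffle_s t']
    end.

(* The asymmetric shuffle of [c] with [c']: each component of [c] is one letter,
   while [c'] is broken into its individual brackets. *)
Definition asym_shuffle (c c' : word) : seq word :=
  [seq flatten u | u <- shuffle (components c) [seq [:: b] | b <- c']].

Lemma asym_shuffle_balanced c c' w :
  balanced c' -> w \in asym_shuffle c c' -> balanced w.
Proof.
have H: forall s v h u, all (scan 0) s -> scan h v ->
    u \in shuffle s [seq [:: b] | b <- v] -> scan h (flatten u).
  elim=> [|x s IHs] v h u.
    by move=> _ Hv; rewrite [shuffle _ _](_ : _ = [:: [seq [:: b] | b <- v]]);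
      [rewrite inE => /eqP->; rewrite flatten_seq1 | case: (v)].
  elim: v h u => [|b v IHv] h u /andP[Hx Hs] Hv.
    rewrite inE => /eqP->; rewrite /= scan_catl //.
    by apply: (IHs [::] h) => //; case: (s) => [|? ?]; rewrite /= inE.
  rewrite /= mem_cat => /orP[]/mapP[u' u'P ->] /=.
    by rewrite scan_catl //; apply: (IHs (b :: v) h).
  have Hxs : all (scan 0) (x :: s) by rewrite /= Hx.
  case: b Hv => /= [Hv|/andP[-> Hv]]; exact: IHv Hxs Hv u'P.
rewrite !balancedE => bc' /mapP[u uP ->]; apply: H bc' uP.
apply/allP=> d /components_irreducible[c0 bc0 ->].
by rewrite -balancedE enclose_balanced.
Qed.

Local Open Scope ring_scope.

(* [{malg k[B]}] is the vector space over [k] with basis [B], and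
   [{malg k[B * C]}] models the tensor product of [{malg k[B]}] and
   [{malg k[C]}]; see [tens_universal]. *)
Section Tensor.
Variable k : fieldType.

Section LinearExtension.
Variables (B : choiceType) (U : lmodType k).

Definition lin_ext (f : B -> U) (x : {malg k[B]}) : U :=
  \sum_(b <- msupp x) x@_b *: f b.

Lemma lin_extE (f : B -> U) (x : {malg k[B]}) :
  lin_ext f x = \sum_(b <- msupp x) x@_b *: f b.
Proof. by []. Qed.

Lemma lin_extEw (f : B -> U) (x : {malg k[B]}) (d : {fset B}) :
  (msupp x `<=` d)%fset -> lin_ext f x = \sum_(b <- d) x@_b *: f b.
Proof.
move=> le_d; rewrite /lin_ext (big_fset_incl _ le_d) // => b _ bNx.
by rewrite mcoeff_outdom // scale0r.
Qed.

Lemma lin_ext_linear (f : B -> U) : linear (lin_ext f).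
Proof.
move=> a x y; pose d := (msupp x `|` msupp y `|` msupp (a *: x + y))%fset.
rewrite (@lin_extEw _ (a *: x + y) d) ?fsubsetUr //.
rewrite (@lin_extEw _ x d); last by rewrite /d -fsetUA fsubsetUl.
rewrite (@lin_extEw _ y d); last by rewrite /d fsetUAC fsubsetUr.
rewrite scaler_sumr -big_split; apply: eq_bigr => b _ /=.
by rewrite mcoeffD mcoeffZ scalerDl scalerA.
Qed.

HB.instance Definition _ (f : B -> U) :=
  GRing.isLinear.Build k {malg k[B]} U *:%R (lin_ext f) (lin_ext_linear f).

Lemma lin_extU (f : B -> U) b : lin_ext f << b >> = f b.
Proof.
rewrite (@lin_extEw _ _ [fset b]%fset) ?msuppU_le //.
by rewrite big_seq_fset1 mcoeffUU scale1r.
Qed.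

Lemma lin_ext_unique (g : {malg k[B]} -> U) :
  linear g -> g =1 lin_ext (fun b => g << b >>).
Proof.
move=> g_lin x.
have g0 : g 0 = 0.
  by move: (g_lin (-1) 0 0); rewrite scaler0 addr0 scaleN1r addNr.
have gD : {morph g : y z / y + z}.
  by move=> y z; move: (g_lin 1 y z); rewrite !scale1r.
rewrite {1}[x]monalgE (big_morph g gD g0); apply: eq_bigr => b _.
have -> : << x@_b *g b >> = x@_b *: << b >>.
  by apply/malgP => c; rewrite mcoeffZ !mcoeffU mulrnAr mulr1.
by rewrite -[X in g X]addr0 g_lin g0 addr0.
Qed.

Lemma eq_lin_ext (f g : B -> U) : f =1 g -> lin_ext f =1 lin_ext g.
Proof. by move=> fg x; apply: eq_bigr => b _; rewrite fg. Qed.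

End LinearExtension.

Lemma lin_ext_comp (B : choiceType) (U W : lmodType k) (f : B -> U)
    (g : U -> W) (x : {malg k[B]}) :
  linear g -> g (lin_ext f x) = lin_ext (g \o f) x.
Proof.
move=> g_lin; rewrite [LHS](@lin_ext_unique B W (g \o lin_ext f)) => [|a y z].
  by apply: eq_lin_ext => b /=; rewrite lin_extU.
by rewrite /= lin_ext_linear g_lin.
Qed.

Definition bilin_ext (B C : choiceType) (U : lmodType k) (f : B -> C -> U)
    (x : {malg k[B]}) (y : {malg k[C]}) : U :=
  lin_ext (fun b => lin_ext (f b) y) x.

Definition bilinear_map (V W U : lmodType k) (f : V -> W -> U) : Prop :=
  (forall x, linear (f x)) /\ (forall y, linear (f^~ y)).

Lemma bilin_ext_bilinear (B C : choiceType) (U : lmodType k) (f : B -> C -> U) : bilinear_map (bilin_ext f).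
Proof.
split=> [x a y z|y]; last exact: lin_ext_linear.
rewrite /bilin_ext ![lin_ext _ x]lin_extE scaler_sumr -big_split.
by apply: eq_bigr => b _ /=; rewrite lin_ext_linear scalerDr !scalerA mulrC.
Qed.

Lemma bilin_extU (B C : choiceType) (U : lmodType k) (f : B -> C -> U) b c :
  bilin_ext f << b >> << c >> = f b c.
Proof. by rewrite /bilin_ext !lin_extU. Qed.

Definition tens (B C : choiceType) : {malg k[B]} -> {malg k[C]} ->
    {malg k[(B * C)%type]} :=
  bilin_ext (fun b c => << (b, c) >>).

(* Only meaningful for bilinear [f]: then [tlift f (tens u v) = f u v]. *)
Definition tlift (B C : choiceType) (U : lmodType k)
    (f : {malg k[B]} -> {malg k[C]} -> U) : {malg k[(B * C)%type]} -> U :=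
  lin_ext (fun bc => f << bc.1 >> << bc.2 >>).

Lemma bilin_ext_unique (B C : choiceType) (U : lmodType k)
    (f : {malg k[B]} -> {malg k[C]} -> U) :
  bilinear_map f -> forall x y,
  f x y = bilin_ext (fun b c => f << b >> << c >>) x y.
Proof.
move=> [fr fl] x y; rewrite (lin_ext_unique (fl y)).
by apply: eq_lin_ext => b; rewrite (lin_ext_unique (fr _)).
Qed.

Lemma tens_universal (B C : choiceType) (U : lmodType k)
    (f : {malg k[B]} -> {malg k[C]} -> U) :
  bilinear_map f ->
  [/\ linear (tlift f),
      forall x y, tlift f (tens x y) = f x y
    & forall g, linear g -> (forall x y, g (tens x y) = f x y) -> g =1 tlift f].
Proof.
move=> f_bil; split=> [|x y|g g_lin gE]; first exact: lin_ext_linear.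
  rewrite (bilin_ext_unique f_bil) lin_ext_comp; last exact: lin_ext_linear.
  apply: eq_lin_ext => b /=; rewrite lin_ext_comp; last exact: lin_ext_linear.
  by apply: eq_lin_ext => c; rewrite /= /tlift lin_extU.
move=> t; rewrite (lin_ext_unique g_lin); apply: eq_lin_ext => -[b c] /=.
by rewrite -gE /tens bilin_extU.
Qed.

Lemma tens_bilinear (B C : choiceType) :
  bilinear_map (@tens B C).
Proof. exact: bilin_ext_bilinear. Qed.

Definition tmap (B C B' C' : choiceType)
    (f : {malg k[B]} -> {malg k[B']}) (g : {malg k[C]} -> {malg k[C']}) :
    {malg k[(B * C)%type]} -> {malg k[(B' * C')%type]} :=
  tlift (fun x y => tens (f x) (g y)).

Definition tassoc (B C D : choiceType) :
    {malg k[((B * C) * D)%type]} -> {malg k[(B * (C * D))%type]} :=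
  tlift (fun xy z => tlift (fun x y => tens x (tens y z)) xy).

(* (x (x) y)(x' (x) y') = xx' (x) yy' *)
Definition tmul (B : choiceType)
    (mul : {malg k[B]} -> {malg k[B]} -> {malg k[B]})
    (s t : {malg k[(B * B)%type]}) : {malg k[(B * B)%type]} :=
  tlift (fun x y => tlift (fun x' y' => tens (mul x x') (mul y y')) t) s.

End Tensor.

Section Hopf.
Variables (k : fieldType) (B : choiceType).
Local Notation A := {malg k[B]}.
Variables (mul : A -> A -> A) (one : A).
Variables (Delta : A -> {malg k[(B * B)%type]}) (eps : A -> k).

Record is_algebra : Prop := IsAlgebra {
  alg_bilinear : bilinear_map mul;
  alg_assoc : associative mul;
  alg_unitl : left_id one mul;
  alg_unitr : right_id one mul }.

Record is_coalgebra : Prop := IsCoalgebra {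
  coalg_linear : linear Delta;
  coalg_counit_linear : scalar eps;
  coalg_coassoc : forall x,
    tassoc (tmap Delta id (Delta x)) = tmap id Delta (Delta x);
  coalg_counitl : forall x, tlift (fun y z => eps y *: z) (Delta x) = x;
  coalg_counitr : forall x, tlift (fun y z => eps z *: y) (Delta x) = x }.

Record is_bialgebra : Prop := IsBialgebra {
  bialg_algebra : is_algebra;
  bialg_coalgebra : is_coalgebra;
  bialg_deltaM : forall x y, Delta (mul x y) = tmul mul (Delta x) (Delta y);
  bialg_delta1 : Delta one = tens one one;
  bialg_epsM : forall x y, eps (mul x y) = eps x * eps y;
  bialg_eps1 : eps one = 1 }.

Record is_antipode (S : A -> A) : Prop := IsAntipode {
  antipode_linear : linear S;
  antipode_l : forall x, tlift (fun y z => mul (S y) z) (Delta x) = eps x *: one;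
  antipode_r : forall x, tlift (fun y z => mul y (S z)) (Delta x) = eps x *: one }.

Definition is_hopf : Prop := is_bialgebra /\ exists S, is_antipode S.

Variable gr : nat -> A -> Prop.

Record is_grading : Prop := IsGrading {
  grading0 : forall n, gr n 0;
  grading_lin : forall n a x y, gr n x -> gr n y -> gr n (a *: x + y);
  grading_sum : forall x, exists N (y : nat -> A),
    (forall n, gr n (y n)) /\ x = \sum_(n < N) y n;
  grading_direct : forall N (y : nat -> A), (forall n, gr n (y n)) ->
    \sum_(n < N) y n = 0 -> forall n, (n < N)%N -> y n = 0 }.

(* The sum over i + j = n of the images of A_i (x) A_j. *)
Definition tens_gr (n : nat) (t : {malg k[(B * B)%type]}) : Prop :=
  exists2 s : seq (A * A),
    forall p, p \in s -> exists i j, [/\ (i + j)%N = n, gr i p.1 & gr j p.2]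
    & t = \sum_(p <- s) tens p.1 p.2.

Record is_graded_connected_hopf : Prop := IsGradedConnectedHopf {
  gch_hopf : is_hopf;
  gch_grading : is_grading;
  gch_mul : forall m n x y, gr m x -> gr n y -> gr (m + n)%N (mul x y);
  gch_delta : forall n x, gr n x -> tens_gr n (Delta x);
  gch_connected : forall x, gr 0 x <-> exists a, x = a *: one;
  gch_eps1 : eps one = 1;
  gch_eps_pos : forall n x, (0 < n)%N -> gr n x -> eps x = 0 }.

End Hopf.

Section PlanarTrees.
Variable k : fieldType.
Local Notation kP := {malg k[ptree]}.

Definition kP_gr (n : nat) (x : kP) : Prop :=
  forall T, T \in msupp x -> nonroot T = n.

Definition circ : kP -> kP -> kP :=
  bilin_ext (fun T T' =>
    \sum_(w <- asym_shuffle (bba_of T) (bba_of T')) << tree_of w >>).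

Definition Delta : kP -> {malg k[(ptree * ptree)%type]} :=
  lin_ext (fun T =>
    let cs := components (bba_of T) in
    \sum_(i < (size cs).+1)
      tens << tree_of (flatten (take i cs)) >>
           << tree_of (flatten (drop i cs)) >>).

Definition bullet : kP := << Node [::] >>.

Definition counit (x : kP) : k := x@_(Node [::]).

End PlanarTrees.

(* Main.v *)
(* Write a tree as the forest F of its branches, let Delta F = sum of
   F_1 (x) F_2 be deconcatenation, and let <G> be the one-branch forest enclosing
   G.  Cutting the shuffles at the two brackets of <H> gives
     F o (G <H> K) = sum of (F_1 o G) <F_2 o H> (F_3 o K).
   With G empty, this identity and an induction on the second factor show that
   Delta is multiplicative; then, by induction on H, both (F o G) o H and
   F o (G o H) unfold to the same sum, so o is associative.  As the bialgebra is
   connected, the antipode is the convolution inverse of the identity given by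
   the (locally finite) geometric series of Takeuchi. *)
Require Import Defs.
From mathcomp Require Import all_boot all_order all_algebra finmap.

Set Implicit Arguments.
Unset Strict Implicit.
Unset Printing Implicit Defensive.

Import GRing.Theory.

Local Open Scope ring_scope.

Arguments shuffle : simpl never.

(** * Cuts of a list and shuffles of two lists *)

Section Splits.
Variable X : Type.
Implicit Types s t : seq X.

Fixpoint splits s : seq (seq X * seq X) :=
  ([::], s) :: if s is x :: s' then [seq (x :: p.1, p.2) | p <- splits s'] else [::].

Lemma splits_nil : splits [::] = [:: ([::], [::])].
Proof. by []. Qed.

Lemma shuffle0s t : shuffle [::] t = [:: t].
Proof. by case: t. Qed.

Lemma shuffles0 s : shuffle s [::] = [:: s].
Proof. by case: s. Qed.

Lemma shuffle_cons x s y t :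
  shuffle (x :: s) (y :: t) =
  [seq x :: u | u <- shuffle s (y :: t)] ++ [seq y :: u | u <- shuffle (x :: s) t].
Proof. by []. Qed.

Section Sums.
Variable V : nmodType.

Lemma big_splits_cons x s (f : seq X -> seq X -> V) :
  \sum_(p <- splits (x :: s)) f p.1 p.2 =
  f [::] (x :: s) + \sum_(p <- splits s) f (x :: p.1) p.2.
Proof. by rewrite big_cons big_map. Qed.

Lemma big_splits_take_drop s (f : seq X -> seq X -> V) :
  \sum_(i < (size s).+1) f (take i s) (drop i s) = \sum_(p <- splits s) f p.1 p.2.
Proof.
elim: s f => [|x s IHs] f; first by rewrite big_ord1 big_seq1.
rewrite big_ord_recl big_splits_cons; congr (_ + _).
exact: (IHs (fun a b => f (x :: a) b)).
Qed.

(** Coassociativity of deconcatenation: either side runs over the cuts of [s] into three consecutive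
    pieces. *)
Lemma big_splitsA s (f : seq X -> seq X -> seq X -> V) :
  \sum_(p <- splits s) \sum_(q <- splits p.1) f q.1 q.2 p.2 =
  \sum_(p <- splits s) \sum_(q <- splits p.2) f p.1 q.1 q.2.
Proof.
elim: s f => [|x s IHs] f; first by rewrite !big_seq1.
rewrite (big_splits_cons x s (fun a b => \sum_(q <- splits a) f q.1 q.2 b)) big_seq1.
rewrite [RHS](big_splits_cons x s (fun a b => \sum_(q <- splits b) f a q.1 q.2)).
rewrite (big_splits_cons x s (f [::])) -addrA; congr (_ + _).
rewrite -(IHs (fun a => f (x :: a))) -big_split; apply: eq_bigr => p _.
by rewrite (big_splits_cons x p.1 (fun a b => f a b p.2)).
Qed.

(** A cut falls either before the marked letter [x], inside or at the ends of [s], or after it. *)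
Lemma big_splits_cat_cons s x t (f : seq X -> seq X -> V) :
  \sum_(p <- splits (s ++ x :: t)) f p.1 p.2 =
  \sum_(p <- splits s) f p.1 (p.2 ++ x :: t)
  + \sum_(p <- splits t) f (s ++ x :: p.1) p.2.
Proof.
elim: s f => [|y s IHs] f; first by rewrite big_splits_cons big_seq1.
rewrite cat_cons !big_splits_cons (IHs (fun a => f (y :: a))) addrA.
by rewrite (big_splits_cons y s (fun a b => f a (b ++ x :: t))).
Qed.

(** The letters of [s] to the left of the marked letter [b] form a prefix of [s], shuffled with
    [t1]; independently, the rest of [s] is shuffled with [t2]. *)
Lemma big_shuffle_cat_cons s t1 b t2 (f : seq X -> V) :
  \sum_(w <- shuffle s (t1 ++ b :: t2)) f w =
  \sum_(p <- splits s) \sum_(u <- shuffle p.1 t1) \sum_(v <- shuffle p.2 t2)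
    f (u ++ b :: v).
Proof.
elim: s t1 f => [|x s IHs] t1 f.
  by rewrite shuffle0s splits_nil !big_seq1 !shuffle0s !big_seq1.
rewrite (big_splits_cons x s (fun a c =>
  \sum_(u <- shuffle a t1) \sum_(v <- shuffle c t2) f (u ++ b :: v))) shuffle0s big_seq1.
(* A shuffle that starts with [x] is covered by [IHs], one that starts with a letter of the second
   word by this inner induction. *)
elim: t1 f => [|y t1 IHt] f.
  rewrite shuffle_cons big_cat !big_map (IHs [::]) addrC; congr (_ + _).
  by apply: eq_bigr => p _; rewrite shuffles0 !big_seq1.
rewrite cat_cons shuffle_cons big_cat !big_map -cat_cons IHs IHt. rewrite /= addrCA.
congr (_ + _); rewrite -big_split; apply: eq_bigr => p _ /=.
by rewrite shuffle_cons big_cat !big_map.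
Qed.

End Sums.

End Splits.

Lemma splits_map (X Y : Type) (h : X -> Y) s :
  splits (map h s) = [seq (map h p.1, map h p.2) | p <- splits s].
Proof.
elim: s => [|x s IHs] //=; rewrite IHs -!map_comp.
by congr (_ :: _); apply: eq_map.
Qed.

(** * Products of forests, each tree being replaced by the list of its branches *)

Definition graft (F G : seq ptree) : seq (seq ptree) :=
  [seq branches (tree_of w) | w <- asym_shuffle (bba_of (Node F)) (bba_of (Node G))].

Lemma branchesK T : Node (branches T) = T.
Proof. by case: T. Qed.

Lemma components_bba_of T :
  components (bba_of T) = [seq enclose (bba_of t) | t <- branches T].
Proof. by rewrite /components bba_ofK. Qed.

Lemma bba_of_cat F G :
  bba_of (Node (F ++ G)) = bba_of (Node F) ++ bba_of (Node G).
Proof. by rewrite /= map_cat flatten_cat. Qed.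

Lemma bba_of_cons F G :
  bba_of (Node (Node F :: G)) = true :: bba_of (Node F) ++ false :: bba_of (Node G).
Proof. by rewrite /= cat_rcons. Qed.

Lemma graftF0 F : graft F [::] = [:: F].
Proof.
rewrite /graft /asym_shuffle components_bba_of shuffles0 /=.
by rewrite -[flatten _]/(bba_of (Node F)) bba_ofK.
Qed.

Lemma graft0F G : graft [::] G = [:: G].
Proof.
rewrite /graft /asym_shuffle components_bba_of shuffle0s.
by rewrite /= flatten_seq1 -[flatten _]/(bba_of (Node G)) bba_ofK.
Qed.

(** The pieces left after cutting a shuffle at a matching pair of brackets are again shuffles of
    this kind, so [tree_ofK] applies to each of them. *)
Lemma shuffle_balanced F G u :
  u \in shuffle [seq enclose (bba_of t) | t <- F] [seq [:: b] | b <- bba_of (Node G)] ->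
  balanced (flatten u).
Proof.
move=> uP; apply: (@asym_shuffle_balanced (bba_of (Node F)) (bba_of (Node G))).
  exact: bba_of_balanced.
by rewrite /asym_shuffle components_bba_of map_f.
Qed.

Section GraftSums.
Variable V : nmodType.

Lemma big_graft (F G : seq ptree) (f : seq ptree -> V) :
  \sum_(w <- graft F G) f w =
  \sum_(u <- shuffle [seq enclose (bba_of t) | t <- F]
                     [seq [:: b] | b <- bba_of (Node G)])
    f (branches (tree_of (flatten u))).
Proof. by rewrite !big_map components_bba_of. Qed.

(** The shuffle is cut first at the opening and then at the closing bracket of [Node g]; each cut
    leaves a prefix of the remaining branches of [F] on its left. *)
Lemma big_graft_cat_cons F G1 g G2 (f : seq ptree -> V) :
  \sum_(w <- graft F (G1 ++ Node g :: G2)) f w =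
  \sum_(p <- splits F) \sum_(q <- splits p.2)
    \sum_(a <- graft p.1 G1) \sum_(u <- graft q.1 g) \sum_(v <- graft q.2 G2)
      f (a ++ Node u :: v).
Proof.
rewrite big_graft bba_of_cat bba_of_cons map_cat map_cons map_cat map_cons.
rewrite big_shuffle_cat_cons splits_map big_map; apply: eq_bigr => p _ /=.
rewrite [in RHS]exchange_big big_graft; apply: eq_big_seq => a /shuffle_balanced ba /=.
rewrite big_shuffle_cat_cons splits_map big_map; apply: eq_bigr => q _ /=.
rewrite big_graft; apply: eq_big_seq => u /shuffle_balanced bu.
rewrite big_graft; apply: eq_big_seq => v /shuffle_balanced bv.
congr f; rewrite flatten_cat /= flatten_cat /=.
(* Each balanced piece is the word of a forest, and the three words assemble into the word of a
   single forest, which [tree_of] decodes. *)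
rewrite -(tree_ofK ba) -(tree_ofK bu) -(tree_ofK bv).
rewrite -[tree_of (flatten a)]branchesK -[tree_of (flatten u)]branchesK.
rewrite -[tree_of (flatten v)]branchesK -bba_of_cons -bba_of_cat !bba_ofK.
by [].
Qed.

Lemma big_graft_cons F g G (f : seq ptree -> V) :
  \sum_(w <- graft F (Node g :: G)) f w =
  \sum_(p <- splits F) \sum_(q <- splits p.2)
    \sum_(u <- graft q.1 g) \sum_(v <- graft q.2 G) f (p.1 ++ Node u :: v).
Proof.
rewrite (big_graft_cat_cons F [::]); apply: eq_bigr => p _; apply: eq_bigr => q _.
by rewrite graftF0 big_seq1.
Qed.

(** Multiplicativity of the coproduct on forests, by induction on [G]: a cut of a term falls to the
    left or to the right of the tree grown from the first branch of [G]. *)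
Lemma big_graft_splits F G (f : seq ptree -> seq ptree -> V) :
  \sum_(w <- graft F G) \sum_(p <- splits w) f p.1 p.2 =
  \sum_(p <- splits F) \sum_(q <- splits G)
    \sum_(u <- graft p.1 q.1) \sum_(v <- graft p.2 q.2) f u v.
Proof.
elim: G F f => [|[g] G IHG] F f.
  rewrite graftF0 big_seq1; apply: eq_bigr => p _.
  by rewrite !big_seq1 !graftF0 !big_seq1.
rewrite big_graft_cons.
under eq_bigr do under eq_bigr do under eq_bigr do
  (under eq_bigr do rewrite big_splits_cat_cons; rewrite big_split /=).
under eq_bigr do (under eq_bigr do rewrite big_split /=; rewrite big_split /=).
rewrite big_split /=.
(* The cuts of the second factor with empty left part are isolated; they match the cuts to the left
   of the new tree. *)
under [RHS]eq_bigr => p _ do rewrite (big_splits_cons _ _ (fun a b =>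
  \sum_(u <- graft p.1 a) \sum_(v <- graft p.2 b) f u v)) graftF0 big_seq1.
rewrite big_split /=; congr (_ + _).
  (* Cut to the left of the new tree: both sides divide [F] into four consecutive pieces. *)
  under [RHS]eq_bigr do rewrite big_graft_cons.
  rewrite -(big_splitsA F (fun a b c => \sum_(q <- splits c)
    \sum_(u <- graft q.1 g) \sum_(v <- graft q.2 G) f a (b ++ Node u :: v))).
  apply: eq_bigr => p _; rewrite [RHS]exchange_big; apply: eq_bigr => q _ /=.
  by rewrite [RHS]exchange_big; apply: eq_bigr => u _; rewrite exchange_big.
(* Cut to the right of the new tree: two regroupings of the pieces of [F] expose the last piece
   [q.2], to which the induction hypothesis applies. *)
under [RHS]eq_bigr => p _ do (
  under eq_bigr do rewrite big_graft_cons; rewrite exchange_big /=).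
rewrite (big_splitsA F (fun a b c => \sum_(i <- splits G) \sum_(q <- splits b)
  \sum_(u <- graft q.1 g) \sum_(u' <- graft q.2 i.1) \sum_(v <- graft c i.2)
    f (a ++ Node u :: u') v)).
apply: eq_bigr => p _; under [RHS]eq_bigr do rewrite exchange_big /=.
rewrite (big_splitsA p.2 (fun a b c => \sum_(i <- splits G)
  \sum_(u <- graft a g) \sum_(u' <- graft b i.1) \sum_(v <- graft c i.2)
    f (p.1 ++ Node u :: u') v)).
apply: eq_bigr => q _.
under [RHS]eq_bigr do rewrite exchange_big /=.
rewrite [RHS]exchange_big; apply: eq_bigr => u _ /=.
exact: (IHG q.2 (fun a b => f (p.1 ++ Node u :: a) b)).
Qed.

(** Associativity on forests, by induction on the tree [Node H] for all [F] and [G] at once. *)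
Lemma big_graftA F G H (f : seq ptree -> V) :
  \sum_(w <- graft F G) \sum_(x <- graft w H) f x =
  \sum_(w <- graft G H) \sum_(x <- graft F w) f x.
Proof.
rewrite -[H]/(branches (Node H)); move: (Node H) F G f => {H}.
(* Two inductions, on the tree and on its list of branches, give the claim for the forest [h] inside
   the first branch and for the forest [s] of the other branches. *)
elim/ptree_rect_seq; elim=> [|[h] s IHs] /= => [_|[IHh /IHs{}IHs]] F G f.
  rewrite graftF0 big_seq1; apply: eq_bigr => w _.
  by rewrite graftF0 big_seq1.
under eq_bigr do rewrite big_graft_cons.
rewrite (big_graft_splits F G (fun a b => \sum_(q <- splits b)
  \sum_(u <- graft q.1 h) \sum_(v <- graft q.2 s) f (a ++ Node u :: v))).
rewrite big_graft_cons exchange_big; apply: eq_bigr => r _ /=.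
(* The right side is expanded at the tree [Node u] of a term of the inner product; the exchanges
   that follow only align the order of summation with the left side. *)
under [RHS]eq_bigr => r' _ do
  (under eq_bigr do (under eq_bigr do rewrite big_graft_cat_cons;
    rewrite exchange_big /=); rewrite exchange_big /=).
rewrite [RHS]exchange_big; apply: eq_bigr => p _ /=.
under [RHS]eq_bigr => r' _ do
  (under eq_bigr do (under eq_bigr do rewrite exchange_big /=;
    rewrite exchange_big /=); rewrite exchange_big /=).
rewrite [RHS]exchange_big; apply: eq_bigr => a _ /=.
(* A second use of multiplicativity cuts [F] and [G] into three pieces each on the left side too. *)
rewrite (big_graft_splits p.2 r.2 (fun b c =>
  \sum_(u <- graft b h) \sum_(v <- graft c s) f (a ++ Node u :: v))).
rewrite exchange_big; apply: eq_bigr => r' _ /=.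
under [RHS]eq_bigr do rewrite exchange_big /=.
rewrite [RHS]exchange_big; apply: eq_bigr => p' _ /=.
(* Two smaller associativities remain: to the right of the new tree, by [IHs], and inside it, by
   [IHh]. *)
under eq_bigr do (rewrite exchange_big /=;
  under eq_bigr do rewrite (IHs _ _ (fun v => f (a ++ Node _ :: v)))).
rewrite (IHh _ _ (fun u => \sum_(w <- graft r'.2 s) \sum_(v <- graft p'.2 w)
  f (a ++ Node u :: v))).
by apply: eq_bigr => u1 _; rewrite exchange_big.
Qed.

End GraftSums.

(** * Degrees of the terms, and cuts with an empty part *)

Section SplitsMem.
Variable X : eqType.
Implicit Types s t : seq X.

Lemma splits_cat s p : p \in splits s -> p.1 ++ p.2 = s.
Proof.
elim: s p => [|x s IHs] p /=; first by rewrite inE => /eqP->.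
rewrite inE => /orP[/eqP->|] //; by case/mapP=> q /IHs qs -> /=; rewrite qs.
Qed.

Lemma shuffle_perm s t u : u \in shuffle s t -> perm_eq u (s ++ t).
Proof.
elim: s t u => [|x s IHs] t u; first by rewrite shuffle0s inE => /eqP->.
elim: t u => [|y t IHt] u; first by rewrite shuffles0 cats0 inE => /eqP->.
rewrite shuffle_cons mem_cat => /orP[]/mapP[v vP ->].
  by rewrite /= perm_cons IHs.
by rewrite perm_sym perm_catC cat_cons perm_cons perm_catC perm_sym IHt.
Qed.

End SplitsMem.

Lemma nonroot_cat F G : nonroot (Node (F ++ G)) = (nonroot (Node F) + nonroot (Node G))%N.
Proof. by rewrite /= map_cat sumn_cat. Qed.

Lemma nonroot_eq0 F : (nonroot (Node F) == 0)%N = nilp F.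
Proof. by case: F. Qed.

(** Non-root vertices are counted by opening brackets, and a shuffle only permutes letters. *)
Lemma nonroot_graft F G w :
  w \in graft F G -> nonroot (Node w) = (nonroot (Node F) + nonroot (Node G))%N.
Proof.
case/mapP=> v; rewrite /asym_shuffle components_bba_of => /mapP[u uP ->] ->.
rewrite branchesK -!(count_bba_of _).1 tree_ofK ?(shuffle_balanced uP) //.
move/seq.permP: (perm_flatten (shuffle_perm uP)) => ->.
by rewrite flatten_cat flatten_seq1 count_cat.
Qed.

Section SplitsNil.
Variables (X : Type) (V : nmodType).

(** Exactly one cut has an empty left part. With its mirror image, this gives the counit axioms and
    the unit laws of convolution. *)
Lemma big_splits_nilpl s (f : seq X -> V) :
  \sum_(p <- splits s) (if nilp p.1 then f p.2 else 0) = f s.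
Proof.
case: s => [|x s]; first by rewrite big_seq1.
rewrite (big_splits_cons x s (fun a b => if nilp a then f b else 0)).
by rewrite /= big1_eq addr0.
Qed.

Lemma big_splits_nilpr s (f : seq X -> V) :
  \sum_(p <- splits s) (if nilp p.2 then f p.1 else 0) = f s.
Proof.
elim: s f => [|x s IHs] f; first by rewrite big_seq1.
rewrite (big_splits_cons x s (fun a b => if nilp b then f a else 0)).
by rewrite (IHs (fun a => f (x :: a))) /= add0r.
Qed.

End SplitsNil.

(** * Linear and bilinear maps computed on bases *)

Section LinearMaps.
Variable k : fieldType.
Implicit Types U V W : lmodType k.

Lemma linear_comp U V W (f : V -> W) (g : U -> V) :
  linear f -> linear g -> linear (fun x => f (g x)).
Proof. by move=> fl gl a x y; rewrite gl fl. Qed.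

Lemma linear_map0 U V (f : U -> V) : linear f -> f 0 = 0.
Proof. by move=> fl; move: (fl (-1) 0 0); rewrite scaler0 addr0 scaleN1r addNr. Qed.

Lemma linear_mapD U V (f : U -> V) x y : linear f -> f (x + y) = f x + f y.
Proof. by move=> fl; move: (fl 1 x y); rewrite !scale1r. Qed.

Lemma linear_mapZ U V (f : U -> V) a x : linear f -> f (a *: x) = a *: f x.
Proof. by move=> fl; move: (fl a x 0); rewrite (linear_map0 fl) !addr0. Qed.

Lemma linear_map_sum U V (f : U -> V) I (r : seq I) (F : I -> U) :
  linear f -> f (\sum_(i <- r) F i) = \sum_(i <- r) f (F i).
Proof.
move=> fl; apply: (big_morph f (fun x y => linear_mapD x y fl) (linear_map0 fl)).
Qed.

Lemma bilinear_map_sum U V W (f : U -> V -> W) I J (r : seq I) (s : seq J)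
    (F : I -> U) (G : J -> V) :
  bilinear_map f ->
  f (\sum_(i <- r) F i) (\sum_(j <- s) G j) =
  \sum_(i <- r) \sum_(j <- s) f (F i) (G j).
Proof.
move=> [fr fl]; rewrite (linear_map_sum _ _ (fl _)).
by apply: eq_bigr => i _; rewrite (linear_map_sum _ _ (fr _)).
Qed.

Lemma linear_basis_ext (B : choiceType) U (f g : {malg k[B]} -> U) :
  linear f -> linear g -> (forall b, f << b >> = g << b >>) -> f =1 g.
Proof.
move=> fl gl fg x; rewrite (lin_ext_unique fl) (lin_ext_unique gl).
exact: eq_lin_ext.
Qed.

Lemma tlift_linear (B C : choiceType) U (f : {malg k[B]} -> {malg k[C]} -> U) :
  linear (tlift f).
Proof. exact: lin_ext_linear. Qed.

Lemma tliftU (B C : choiceType) U (f : {malg k[B]} -> {malg k[C]} -> U) b c :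
  tlift f << (b, c) >> = f << b >> << c >>.
Proof. exact: lin_extU. Qed.

Lemma tensU (B C : choiceType) (b : B) (c : C) :
  tens (<< b >> : {malg k[B]}) << c >> = << (b, c) >>.
Proof. exact: bilin_extU. Qed.

Lemma tmul_bilinear (B : choiceType) (mul : {malg k[B]} -> {malg k[B]} -> {malg k[B]}) :
  bilinear_map (tmul mul).
Proof. exact: bilin_ext_bilinear. Qed.

Lemma tmulU (B : choiceType) (mul : {malg k[B]} -> {malg k[B]} -> {malg k[B]}) b c b' c' :
  tmul mul << (b, c) >> << (b', c') >> =
  tens (mul << b >> << b' >>) (mul << c >> << c' >>).
Proof. by rewrite /tmul !tliftU. Qed.

(** Consecutive signs are opposite, so only the end terms survive. Applied to convolution powers,
    this makes the geometric series an inverse. *)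
Lemma alternating_telescope V (a : nat -> V) N :
  \sum_(n < N) (-1) ^+ n *: (a n + a n.+1) = a 0 - (-1) ^+ N *: a N.
Proof.
elim: N => [|N IHN]; first by rewrite big_ord0 scale1r subrr.
by rewrite big_ord_recr /= IHN exprS mulN1r scaleNr opprK scalerDr addrA subrK.
Qed.

End LinearMaps.

(** * The bialgebra structure *)

Section Hopf.
Variable k : fieldType.
Local Notation kP := {malg k[ptree]}.
Local Notation e F := (<< Node F >> : kP).

Lemma forest_basis_ext (U : lmodType k) (f g : kP -> U) :
  linear f -> linear g -> (forall F, f (e F) = g (e F)) -> f =1 g.
Proof. by move=> fl gl fg; apply: linear_basis_ext => // -[F]. Qed.

Lemma circ_bilinear : bilinear_map (@circ k).
Proof. exact: bilin_ext_bilinear. Qed.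

Lemma circ_linearl y : linear (fun x => circ x y : kP).
Proof. exact: circ_bilinear.2. Qed.

Lemma circ_linearr x : linear (circ x : kP -> kP).
Proof. exact: circ_bilinear.1. Qed.

Lemma circ0r x : circ x 0 = 0 :> kP.
Proof. exact: linear_map0 (circ_linearr x). Qed.

Lemma circ0l x : circ 0 x = 0 :> kP.
Proof. exact: linear_map0 (circ_linearl x). Qed.

Lemma circ_basis F G : circ (e F) (e G) = \sum_(w <- graft F G) e w.
Proof.
by rewrite /circ bilin_extU [RHS]big_map; apply: eq_bigr => w _; rewrite branchesK.
Qed.

Lemma Delta_linear : linear (@Delta k).
Proof. exact: lin_ext_linear. Qed.

(** The components of the word are the encoded branches, so cutting the list of components amounts
    to cutting [F]. *)
Lemma Delta_basis F :
  Delta (e F) = \sum_(p <- splits F) << (Node p.1, Node p.2) >>.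
Proof.
rewrite /Delta lin_extU components_bba_of size_map.
rewrite -(big_splits_take_drop F (fun a b => << (Node a, Node b) >>)).
apply: eq_bigr => i _; rewrite -map_take -map_drop /=.
by rewrite -!/(bba_of (Node _)) !bba_ofK tensU.
Qed.

Lemma tlift_Delta (U : lmodType k) (f : kP -> kP -> U) F :
  tlift f (Delta (e F)) = \sum_(p <- splits F) f (e p.1) (e p.2).
Proof.
rewrite Delta_basis (linear_map_sum _ _ (tlift_linear f)).
by apply: eq_bigr => p _; rewrite tliftU.
Qed.

Lemma circA : associative (@circ k).
Proof.
move=> x y z; move: x; apply: forest_basis_ext => [||F].
- exact: circ_linearl.
- exact: (linear_comp (circ_linearl z) (circ_linearl y)).
move: y; apply: forest_basis_ext => [||G].
- exact: (linear_comp (circ_linearr _) (circ_linearl z)).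
- exact: (linear_comp (circ_linearl z) (circ_linearr _)).
move: z; apply: forest_basis_ext => [||H].
- exact: (linear_comp (circ_linearr _) (circ_linearr _)).
- exact: circ_linearr.
rewrite !circ_basis (linear_map_sum _ _ (circ_linearr _)).
rewrite (linear_map_sum _ _ (circ_linearl _)).
under eq_bigr do rewrite circ_basis.
by under [RHS]eq_bigr do rewrite circ_basis; rewrite big_graftA.
Qed.

Lemma circ1x : left_id (bullet k) (@circ k).
Proof.
apply: forest_basis_ext => [|a x y|F] //; first exact: circ_linearr.
by rewrite /bullet circ_basis graft0F big_seq1.
Qed.

Lemma circx1 : right_id (bullet k) (@circ k).
Proof.
apply: forest_basis_ext => [|a x y|F] //; first exact: circ_linearl.
by rewrite /bullet circ_basis graftF0 big_seq1.
Qed.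

Lemma circ_is_algebra : is_algebra (@circ k) (bullet k).
Proof.
split; [exact: circ_bilinear|exact: circA|exact: circ1x|exact: circx1].
Qed.

Lemma counit_linear : scalar (@counit k).
Proof. by move=> a x y; rewrite /counit mcoeffD mcoeffZ. Qed.

Lemma counit_basis F : counit (e F) = (nilp F)%:R :> k.
Proof.
rewrite /counit mcoeffU; congr ((nat_of_bool _)%:R).
by apply/eqP/nilP => [[]|->].
Qed.

Lemma counit_basis_scale (V : lmodType k) F (v : V) :
  counit (e F) *: v = if nilp F then v else 0.
Proof. by rewrite counit_basis; case: nilp; rewrite ?scale1r ?scale0r. Qed.

(** By linearity it suffices to treat a forest, where the claim is [big_splitsA]. *)
Lemma Delta_coassoc (x : kP) :
  tassoc (tmap (@Delta k) id (Delta x)) = tmap id (@Delta k) (Delta x).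
Proof.
move: x; apply: forest_basis_ext => [||F].
- exact: (linear_comp (@tlift_linear _ _ _ _ _)
    (linear_comp (@tlift_linear _ _ _ _ _) Delta_linear)).
- exact: (linear_comp (@tlift_linear _ _ _ _ _) Delta_linear).
have TB := @tens_bilinear k; rewrite /tmap !tlift_Delta.
under eq_bigr => p _ do
  rewrite /= Delta_basis (linear_map_sum _ _ ((TB _ _).2 _)).
rewrite /tassoc (linear_map_sum _ _ (@tlift_linear _ _ _ _ _)).
under eq_bigr => p _ do rewrite (linear_map_sum _ _ (@tlift_linear _ _ _ _ _)).
under eq_bigr => p _ do under eq_bigr => q _ do
  rewrite [tens _ _]tensU !tliftU !tensU.
rewrite (big_splitsA F (fun a b c => << (Node a, (Node b, Node c)) >>)).
apply: eq_bigr => p _; rewrite Delta_basis (linear_map_sum _ _ ((TB _ _).1 _)).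
by apply: eq_bigr => q _; rewrite tensU.
Qed.

Lemma Delta_is_coalgebra : is_coalgebra (@Delta k) (@counit k).
Proof.
split; [exact: Delta_linear|exact: counit_linear|exact: Delta_coassoc| |].
- apply: (@forest_basis_ext _ _ id) => [|a x y|F] //.
    exact: (linear_comp (@tlift_linear _ _ _ _ _) Delta_linear).
  rewrite tlift_Delta; under eq_bigr do rewrite counit_basis_scale.
  exact: (big_splits_nilpl F (fun a => e a)).
- apply: (@forest_basis_ext _ _ id) => [|a x y|F] //.
    exact: (linear_comp (@tlift_linear _ _ _ _ _) Delta_linear).
  rewrite tlift_Delta; under eq_bigr do rewrite counit_basis_scale.
  exact: (big_splits_nilpr F (fun a => e a)).
Qed.

Lemma DeltaM (x y : kP) : Delta (circ x y) = tmul (@circ k) (Delta x) (Delta y).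
Proof.
have [TMr TMl] := tmul_bilinear (@circ k).
move: x; apply: forest_basis_ext => [||F].
- exact: (linear_comp Delta_linear (circ_linearl _)).
- exact: (linear_comp (TMl _) Delta_linear).
move: y; apply: forest_basis_ext => [||G].
- exact: (linear_comp Delta_linear (circ_linearr _)).
- exact: (linear_comp (TMr _) Delta_linear).
rewrite circ_basis (linear_map_sum _ _ Delta_linear).
under eq_bigr do rewrite Delta_basis.
rewrite (big_graft_splits F G (fun a b => << (Node a, Node b) >>)).
rewrite !Delta_basis (bilinear_map_sum _ _ _ _ (tmul_bilinear _)).
apply: eq_bigr => p _; apply: eq_bigr => q _.
rewrite tmulU !circ_basis (bilinear_map_sum _ _ _ _ (@tens_bilinear k _ _)).
by apply: eq_bigr => u _; apply: eq_bigr => v _; rewrite tensU.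
Qed.

Lemma counitM x y : counit (circ x y) = counit x * counit y :> k.
Proof.
(* Viewing the field as the module [k^o] over itself makes both sides linear in each argument, so it
   suffices to compare them on forests. *)
have cl : linear (@counit k : kP -> k^o) by exact: counit_linear.
have ml (a : k) : linear (fun b : k^o => a * b : k^o).
  by move=> c u v; rewrite mulrDr mulrCA.
have mr (a : k) : linear (fun b : k^o => b * a : k^o).
  by move=> c u v; rewrite mulrDl -mulrA.
move: x; apply: (@forest_basis_ext k^o) => [||F].
- exact: (linear_comp cl (circ_linearl _)).
- exact: (linear_comp (mr _) cl).
move: y; apply: (@forest_basis_ext k^o) => [||G].
- exact: (linear_comp cl (circ_linearr _)).
- exact: (linear_comp (ml _) cl).
rewrite circ_basis (linear_map_sum _ _ cl) !counit_basis.
have [/nilP->|nF] := boolP (nilp F).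
  by rewrite graft0F big_seq1 mul1r counit_basis.
(* By degree, no term of a product with a non-empty left factor is the empty forest. *)
rewrite mul0r big_seq big1 // => w /nonroot_graft nw.
by rewrite counit_basis -nonroot_eq0 nw addn_eq0 nonroot_eq0 (negPf nF).
Qed.

Lemma circ_Delta_is_bialgebra :
  is_bialgebra (@circ k) (bullet k) (@Delta k) (@counit k).
Proof.
split; [exact: circ_is_algebra|exact: Delta_is_coalgebra|exact: DeltaM| |exact: counitM|].
  by rewrite Delta_basis big_seq1 tensU.
exact: counit_basis.
Qed.


(** * Convolution of linear endomorphisms, given by their values on forests, and the antipode *)

Definition conv (f g : seq ptree -> kP) (F : seq ptree) : kP :=
  \sum_(p <- splits F) circ (f p.1) (g p.2).

Lemma convA f g h F : conv (conv f g) h F = conv f (conv g h) F.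
Proof.
rewrite /conv; under eq_bigr do rewrite (linear_map_sum _ _ (circ_linearl _)).
rewrite (big_splitsA F (fun a b c => circ (circ (f a) (g b)) (h c))).
apply: eq_bigr => p _; rewrite (linear_map_sum _ _ (circ_linearr _)).
by apply: eq_bigr => q _; rewrite circA.
Qed.

Lemma eq_conv f f' g g' F : f =1 f' -> g =1 g' -> conv f g F = conv f' g' F.
Proof. by move=> ff gg; apply: eq_bigr => p _; rewrite ff gg. Qed.

(** The counit followed by the unit map, evaluated on forests. *)
Definition conv_unit (F : seq ptree) : kP := if nilp F then bullet k else 0.

Lemma conv1f f F : conv conv_unit f F = f F.
Proof.
rewrite -[RHS]big_splits_nilpl; apply: eq_bigr => p _.
by rewrite /conv_unit; case: nilp; rewrite ?circ1x ?circ0l.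
Qed.

Lemma convf1 f F : conv f conv_unit F = f F.
Proof.
rewrite -[RHS]big_splits_nilpr; apply: eq_bigr => p _.
by rewrite /conv_unit; case: nilp; rewrite ?circx1 ?circ0r.
Qed.

(* The identity minus the convolution unit, locally nilpotent for convolution. *)
Definition aug (F : seq ptree) : kP := if nilp F then 0 else e F.

Lemma basis_aug F : e F = conv_unit F + aug F.
Proof. by case: F => [|t F]; rewrite /conv_unit /aug /= ?addr0 ?add0r. Qed.

Definition conv_pow n : seq ptree -> kP := iter n (conv aug) conv_unit.

(** Powers are built by multiplying with [aug] on the left; the left antipode axiom needs that
    factor on the right. *)
Lemma conv_powS n F : conv_pow n.+1 F = conv (conv_pow n) aug F.
Proof.
elim: n F => [|n IHn] F; first by rewrite /= convf1 conv1f.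
by rewrite [RHS]convA; apply: eq_conv.
Qed.

(** Only cuts into [n] non-empty pieces contribute to the [n]-th power, and these require at least
    [n] branches. *)
Lemma conv_pow_small n F : (size F < n)%N -> conv_pow n F = 0.
Proof.
elim: n F => [|n IHn] F //= lt_F; rewrite /conv big_seq big1 // => p /splits_cat Fp.
rewrite /aug; case: ifP => [_|/negbT]; first by rewrite circ0l.
rewrite /nilp -lt0n => p1; rewrite IHn ?circ0r //.
by rewrite -Fp size_cat ltnS in lt_F; apply: leq_trans lt_F; rewrite -add1n leq_add2r.
Qed.

(** The geometric series inverting [conv_unit + aug]; powers beyond [size F] vanish on [F]. *)
Definition antipode_forest (F : seq ptree) : kP :=
  \sum_(n < (size F).+1) (-1) ^+ n *: conv_pow n F.

(** A larger bound only adds zero terms, so one bound can serve all the pieces of a forest. *)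
Lemma antipode_forestE N F : (size F < N)%N ->
  antipode_forest F = \sum_(n < N) (-1) ^+ n *: conv_pow n F.
Proof.
move=> lt_N; rewrite /antipode_forest.
rewrite (big_ord_widen N (fun n => (-1) ^+ n *: conv_pow n F)) // big_mkcond.
apply: eq_bigr => n _; case: ifP => // /negbT; rewrite -leqNgt => lt_n.
by rewrite conv_pow_small ?scaler0.
Qed.

Lemma alternating_conv_pow F :
  \sum_(n < (size F).+1) (-1) ^+ n *: (conv_pow n F + conv_pow n.+1 F) = conv_unit F.
Proof.
rewrite (alternating_telescope (fun n => conv_pow n F)).
by rewrite (conv_pow_small (ltnSn _)) scaler0 subr0.
Qed.

Lemma conv_antipode_l F : conv antipode_forest (fun G => e G) F = conv_unit F.
Proof.
rewrite -alternating_conv_pow /conv.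
transitivity (\sum_(p <- splits F) \sum_(n < (size F).+1)
    (-1) ^+ n *: circ (conv_pow n p.1) (e p.2)).
  apply: eq_big_seq => p /splits_cat Fp.
  rewrite (@antipode_forestE (size F).+1); last first.
    by rewrite ltnS -Fp size_cat leq_addr.
  rewrite (linear_map_sum _ _ (circ_linearl _)).
  by apply: eq_bigr => n _; rewrite (linear_mapZ _ _ (circ_linearl _)).
rewrite exchange_big; apply: eq_bigr => n _ /=.
rewrite -scaler_sumr -[conv aug _ F]/(conv_pow n.+1 F) conv_powS.
(* Once the lower power is written as a convolution with the unit, both sums merge into one against
   [conv_unit + aug], which is the identity on forests. *)
rewrite -{1}[conv_pow n F]convf1 -big_split; congr (_ *: _).
by apply: eq_bigr => p _; rewrite basis_aug (linear_mapD _ _ (circ_linearr _)).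
Qed.

Lemma conv_antipode_r F : conv (fun G => e G) antipode_forest F = conv_unit F.
Proof.
rewrite -alternating_conv_pow /conv.
transitivity (\sum_(p <- splits F) \sum_(n < (size F).+1)
    (-1) ^+ n *: circ (e p.1) (conv_pow n p.2)).
  apply: eq_big_seq => p /splits_cat Fp.
  rewrite (@antipode_forestE (size F).+1); last first.
    by rewrite ltnS -Fp size_cat leq_addl.
  rewrite (linear_map_sum _ _ (circ_linearr _)).
  by apply: eq_bigr => n _; rewrite (linear_mapZ _ _ (circ_linearr _)).
rewrite exchange_big; apply: eq_bigr => n _ /=.
rewrite -scaler_sumr -{1}[conv_pow n F]conv1f -big_split; congr (_ *: _).
by apply: eq_bigr => p _; rewrite basis_aug (linear_mapD _ _ (circ_linearl _)).
Qed.

Definition antipode : kP -> kP := lin_ext (fun T => antipode_forest (branches T)).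

Lemma antipode_basis F : antipode (e F) = antipode_forest F.
Proof. exact: lin_extU. Qed.

Lemma antipodeP : is_antipode (@circ k) (bullet k) (@Delta k) (@counit k) antipode.
Proof.
have lin1 : linear (fun x => counit x *: bullet k).
  by move=> a x y; rewrite counit_linear scalerDl scalerA.
split; first exact: lin_ext_linear.
- apply: (forest_basis_ext (linear_comp (@tlift_linear _ _ _ _ _) Delta_linear) lin1).
  move=> F; rewrite tlift_Delta counit_basis_scale -[RHS]conv_antipode_l.
  by apply: eq_bigr => p _; rewrite antipode_basis.
- apply: (forest_basis_ext (linear_comp (@tlift_linear _ _ _ _ _) Delta_linear) lin1).
  move=> F; rewrite tlift_Delta counit_basis_scale -[RHS]conv_antipode_r.
  by apply: eq_bigr => p _; rewrite antipode_basis.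
Qed.

(** * Grading and connectedness *)

Lemma kP_grP n (x : kP) : kP_gr n x <-> forall T, x@_T != 0 -> nonroot T = n.
Proof. by split=> H T; move: (H T); rewrite mcoeff_neq0. Qed.

Lemma kP_gr0 n : kP_gr n (0 : kP).
Proof. by apply/kP_grP => T; rewrite mcoeff0 eqxx. Qed.

Lemma kP_gr_lin n a (x y : kP) : kP_gr n x -> kP_gr n y -> kP_gr n (a *: x + y).
Proof.
move=> /kP_grP gx /kP_grP gy; apply/kP_grP => T; rewrite mcoeffD mcoeffZ.
have [xT|/gx//] := eqVneq x@_T 0.
by rewrite xT mulr0 add0r; apply: gy.
Qed.

Lemma kP_gr_basis T : kP_gr (nonroot T) (<< T >> : kP).
Proof. by apply/kP_grP => T'; rewrite mcoeffU; case: (T =P T') => [->|]; rewrite ?eqxx. Qed.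

Lemma kP_gr_sum n (I : eqType) (r : seq I) (F : I -> kP) :
  (forall i, i \in r -> kP_gr n (F i)) -> kP_gr n (\sum_(i <- r) F i).
Proof.
move=> gF; rewrite big_seq; elim/big_ind: _ => [|x y gx gy|i /gF//].
  exact: kP_gr0.
by rewrite -[x]scale1r; apply: kP_gr_lin.
Qed.

Lemma lin_ext_gr m n (f : ptree -> kP) (x : kP) :
  (forall T, nonroot T = m -> kP_gr n (f T)) -> kP_gr m x -> kP_gr n (lin_ext f x).
Proof.
move=> gf gx; apply: kP_gr_sum => T /gx /gf gT.
by rewrite -[_ *: _]addr0; apply: kP_gr_lin gT (kP_gr0 _).
Qed.

Lemma circ_gr m n (x y : kP) : kP_gr m x -> kP_gr n y -> kP_gr (m + n)%N (circ x y).
Proof.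
move=> gx gy; apply: lin_ext_gr gx => -[F] Fm; apply: lin_ext_gr gy => -[G] Gn.
suff: kP_gr (m + n) (circ (e F) (e G)) by rewrite /circ bilin_extU.
rewrite circ_basis; apply: kP_gr_sum => w /nonroot_graft.
by rewrite Fm Gn => <-; apply: kP_gr_basis.
Qed.

(** The projection onto degree [n], which provides homogeneous components and proves that their sum
    is direct. *)
Definition gr_proj (n : nat) : kP -> kP :=
  lin_ext (fun T => if nonroot T == n then << T >> else 0).

Lemma gr_proj_linear n : linear (gr_proj n).
Proof. exact: lin_ext_linear. Qed.

Lemma gr_proj_gr n (x : kP) : kP_gr n (gr_proj n x).
Proof.
apply: kP_gr_sum => T _; rewrite -[_ *: _]addr0; apply: kP_gr_lin (kP_gr0 _).
by case: eqP => [<-|_]; [apply: kP_gr_basis|apply: kP_gr0].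
Qed.

Lemma gr_proj_id m n (x : kP) : kP_gr m x -> gr_proj n x = if m == n then x else 0.
Proof.
move=> gx; rewrite /gr_proj lin_extE.
case: eqP => [mn|mn].
  (* The identity map, linear by reflexivity, is the linear extension of its values on the basis;
     this expands [x] over its support. *)
  rewrite [RHS](lin_ext_unique (fun a u v => erefl : a *: u + v = a *: u + v)).
  by apply: eq_big_seq => T /gx ->; rewrite mn eqxx.
rewrite big_seq big1 // => T /gx ->.
by rewrite (negPf (introN eqP mn)) scaler0.
Qed.

Lemma kP_is_grading : is_grading (@kP_gr k).
Proof.
split; [exact: kP_gr0|exact: kP_gr_lin| |].
(* The bound exceeds every degree in the support by at least one, because the sum runs over
   [n < N]. *)
- move=> x; exists (\max_(T <- msupp x) nonroot T).+1, (fun n => gr_proj n x).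
  split=> [n|]; first exact: gr_proj_gr.
  rewrite /gr_proj /lin_ext exchange_big.
  rewrite [LHS](lin_ext_unique (fun a u v => erefl : a *: u + v = a *: u + v)).
  apply: eq_big_seq => T Tx /=; rewrite -scaler_sumr; congr (_ *: _).
  have lt_T : (nonroot T < (\max_(T <- msupp x) nonroot T).+1)%N.
    by rewrite ltnS; apply: leq_bigmax_seq.
  rewrite (bigD1 (Ordinal lt_T)) //= eqxx big1 ?addr0 // => n.
  by rewrite -val_eqE /= eq_sym => /negPf->.
- move=> N y gy y0 n lt_n.
  (* Projecting the vanishing sum onto degree [n] leaves only [y n]. *)
  have: gr_proj n (\sum_(i < N) y i) = 0.
    by rewrite y0; apply: linear_map0 (gr_proj_linear n).
  rewrite (linear_map_sum _ _ (gr_proj_linear n)).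
  rewrite (bigD1 (Ordinal lt_n)) //= big1 ?addr0 => [|i ne_i].
    by rewrite (gr_proj_id n (gy n)) eqxx.
  rewrite (gr_proj_id n (gy i)).
  by move: ne_i; rewrite -val_eqE /= => /negPf->.
Qed.

(** The lists of homogeneous pure tensors that witness the summands are concatenated. *)
Lemma tens_gr_sum n (I : eqType) (r : seq I) (F : I -> {malg k[(ptree * ptree)%type]}) :
  (forall i, i \in r -> tens_gr (@kP_gr k) n (F i)) ->
  tens_gr (@kP_gr k) n (\sum_(i <- r) F i).
Proof.
elim: r => [|i r IHr] gF; first by exists [::]; rewrite ?big_nil.
have [s1 gs1 e1] := gF i (mem_head _ _).
have [|s2 gs2 e2] := IHr; first by move=> j jr; apply: gF; rewrite inE jr orbT.
exists (s1 ++ s2); last by rewrite big_cons e1 e2 big_cat.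
by move=> p; rewrite mem_cat => /orP[/gs1|/gs2].
Qed.

Lemma Delta_gr n (x : kP) : kP_gr n x -> tens_gr (@kP_gr k) n (Delta x).
Proof.
move=> gx; apply: tens_gr_sum => -[F] /gx nF.
suff: tens_gr (@kP_gr k) n (x@_(Node F) *: Delta (e F)) by rewrite /Delta lin_extU.
rewrite Delta_basis scaler_sumr.
apply: tens_gr_sum => p /splits_cat Fp.
(* The witnesses carry no coefficients, so the scalar is absorbed into the left factor. *)
exists [:: (x@_(Node F) *: e p.1, e p.2)].
  move=> _ /[!inE]/eqP->; exists (nonroot (Node p.1)), (nonroot (Node p.2)).
  split; [by rewrite -nonroot_cat Fp| |exact: kP_gr_basis].
  rewrite -[_ *: _]addr0; apply: kP_gr_lin (kP_gr0 _); exact: kP_gr_basis.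
by rewrite big_seq1 (linear_mapZ _ _ ((@tens_bilinear k _ _).2 _)) tensU.
Qed.

(** The one-vertex tree is the only tree without non-root vertices. *)
Lemma kP_connected (x : kP) : kP_gr 0 x <-> exists a, x = a *: bullet k.
Proof.
split=> [/kP_grP gx|[a ->]]; last first.
  by rewrite -[_ *: _]addr0; apply: kP_gr_lin (kP_gr0 _); exact: kP_gr_basis.
exists x@_(Node [::]); apply/malgP => T; rewrite mcoeffZ mcoeffU.
case: eqP => [<-|ne_T]; first by rewrite mulr1.
rewrite mulr0; apply/eqP; apply: contra_notT ne_T => /gx.
by case: T => -[|t s].
Qed.

Lemma counit_gr_pos n (x : kP) : (0 < n)%N -> kP_gr n x -> counit x = 0 :> k.
Proof.
move=> n0 /kP_grP gx; apply/eqP; apply: contraLR n0 => /gx <-.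
by [].
Qed.

End Hopf.

Theorem theorem5p1 (k : fieldType) (char0 : [pchar k] =i pred0) :
  is_graded_connected_hopf
    (@circ k) (bullet k) (@Delta k) (@counit k) (@kP_gr k).
Proof.
split.
- by split; [exact: circ_Delta_is_bialgebra|exists (@antipode k); exact: antipodeP].
- exact: kP_is_grading.
- exact: circ_gr.
- exact: Delta_gr.
- exact: kP_connected.
- exact: counit_basis.
- exact: counit_gr_pos.
Qed.
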